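(* Let $m\ge 0$ be an integer. The connection coefficients $c_{\ell,j}^m$ ($\ell,j\ge 0$ integers) between $\tilde P_{j+m+2}^{m+2}$ and $\tilde P_{\ell+m}^m$, i.e. the coefficients in the expansion $$\tilde P_{j+m+2}^{m+2}(\cos\theta)=\sum_{\ell\ge 0} c_{\ell,j}^m\,\tilde P_{\ell+m}^m(\cos\theta),\qquad \theta\in[0,\pi],$$ are $$c_{\ell,j}^{m} = \begin{cases} (2\ell+2m+1)(2m+2)\sqrt{\dfrac{(\ell+2m)!}{(\ell+m+\frac12)\,\ell!}\cdot\dfrac{(j+m+\frac52)\,j!}{(j+2m+4)!}}, & \ell\le j,\ \ell+j \text{ even},\\[2ex] -\sqrt{\dfrac{(j+1)(j+2)}{(j+2m+3)(j+2m+4)}}, & \ell=j+2,\\[2ex] 0, & \text{otherwise.}\end{cases}$$ Furthermore, for every integer $n\ge 0$, the matrix of connection coefficients $C^{(m)}=(c_{\ell,j}^m)_{0\le \ell\le n+2,\ 0\le j\le n}\in\mathbb{R}^{(n+3)\times(n+1)}$ is the product of $n+1$ Givens rotations and a rectangular identity: $$C^{(m)} = G_0^{(m)}G_1^{(m)}\cdots G_{n-1}^{(m)}G_{n}^{(m)}\, I_{(n+3)\times(n+1)},$$ where the sines and cosines of the rotation $G_j^{(m)}$ are $$s_j^m=\sqrt{\dfrac{(j+1)(j+2)}{(j+2m+3)(j+2m+4)}},\qquad c_j^m=\sqrt{\dfrac{(2m+2)(2j+2m+5)}{(j+2m+3)(j+2m+4)}}.$$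
   Context: For integers $0\le m\le \ell$, the associated Legendre functions are $P_\ell^m(\cos\theta) = (-2)^m(\tfrac12)_m(\sin\theta)^m C_{\ell-m}^{(m+\frac12)}(\cos\theta)$, where $(x)_k=\Gamma(x+k)/\Gamma(x)$ is the Pochhammer symbol and $C_k^{(\lambda)}$ is the ultraspherical (Gegenbauer) polynomial of degree $k$ in the standard normalization. The normalized associated Legendre functions are $$\tilde P_\ell^m(\cos\theta) = (-1)^m\sqrt{(\ell+\tfrac12)\frac{(\ell-m)!}{(\ell+m)!}}\;P_\ell^m(\cos\theta);$$ for fixed $m$ they are orthonormal in $L^2([-1,1],\mathrm{d}x)$ with $x=\cos\theta$. $I_{p\times q}$ denotes the $p\times q$ matrix with ones on the main diagonal and zeros elsewhere. Rows and columns are indexed from $0$. The Givens rotation $G_j^{(m)}$ is the $(n+3)\times(n+3)$ matrix equal to the identity except in the intersections of rows and columns $j$ and $j+2$, where $(G_j^{(m)})_{j,j}=(G_j^{(m)})_{j+2,j+2}=c_j^m$, $(G_j^{(m)})_{j,j+2}=s_j^m$ and $(G_j^{(m)})_{j+2,j}=-s_j^m$. (The two-index cosines $c_j^m$ are distinct from the three-index connection coefficients $c_{\ell,j}^m$.) *)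

(* Defs.v *)
From HB Require Import structures.
From mathcomp Require Export all_boot all_order all_algebra.
From mathcomp Require Export all_classical all_reals all_analysis.
Set Implicit Arguments.
Unset Strict Implicit.
Unset Printing Implicit Defensive.
Import Order.TTheory GRing.Theory Num.Theory.
Import numFieldNormedType.Exports.
Local Open Scope classical_set_scope.
Local Open Scope ring_scope.

Section Legendre.
Context {R : realType}.
Implicit Types (l m k j : nat) (x theta : R).

(* (x)_k as the rising product x (x + 1) ... (x + k - 1); pochhammerE relates it
   to the quotient Gamma(x + k) / Gamma(x), Gamma being absent from the library. *)
Definition pochhammer x k : R := \prod_(i < k) (x + i%:R).

Lemma pochhammerE (Gamma : R -> R) x k :
    (forall y, 0 < y -> Gamma y != 0) ->
    (forall y, 0 < y -> Gamma (y + 1) = y * Gamma y) ->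
  0 < x -> pochhammer x k = Gamma (x + k%:R) / Gamma x.
Proof.
move=> G0 GS x0; rewrite /pochhammer; elim: k => [|k IHk].
  by rewrite big_ord0 addr0 divff// G0.
rewrite big_ord_recr/= IHk -natr1 addrA GS; last by rewrite ltr_wpDr.
by rewrite [LHS]mulrC mulrA.
Qed.

(* C_k^(lambda)(x) = sum_(0 <= i <= k/2)
     (-1)^i (lambda)_(k-i) / (i! (k - 2i)!) (2 x)^(k - 2i),
   the standard normalization, with generating function
   sum_k C_k^(lambda)(x) t^k = (1 - 2 x t + t^2)^(-lambda). *)
Definition gegenbauer (lambda : R) k x : R :=
  \sum_(i < k./2.+1)
    (-1) ^+ i * pochhammer lambda (k - i) / (i`!%:R * (k - i.*2)`!%:R)
    * (2 * x) ^+ (k - i.*2).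

(* A function of x = cos theta, with sin theta = sqrt (1 - x^2) on [0, pi], see
   assoc_legendre_cos. Both functions below are only meant for m <= l. *)
Definition assoc_legendre l m x : R :=
  (- 2) ^+ m * pochhammer (1 / 2) m * Num.sqrt (1 - x ^+ 2) ^+ m
  * gegenbauer (m%:R + 1 / 2) (l - m) x.

Lemma assoc_legendre_cos l m theta : 0 <= theta <= pi ->
  assoc_legendre l m (cos theta) =
  (- 2) ^+ m * pochhammer (1 / 2) m * sin theta ^+ m
  * gegenbauer (m%:R + 1 / 2) (l - m) (cos theta).
Proof.
by move=> /sin_ge0_pi s0; rewrite /assoc_legendre -sin2cos2 sqrtr_sqr ger0_norm.
Qed.

Definition norm_legendre l m x : R :=
  (-1) ^+ m * Num.sqrt ((l%:R + 1 / 2) * ((l - m)`!%:R / (l + m)`!%:R))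
  * assoc_legendre l m x.

(* f = sum_(l >= 0) a_l phi_l in L^2([-1, 1], dx) *)
Definition L2_expansion (phi : nat -> R -> R) (f : R -> R) (a : nat -> R) :=
  (fun N => \int[lebesgue_measure]_(x in `[(-1)%R, 1%R])
      (((f x - \sum_(0 <= l < N) a l * phi l x) ^+ 2)%:E))%E
    @ \oo --> (0 : \bar R).

(* For fixed m the functions norm_legendre (l + m) m are orthonormal in
   L^2([-1, 1], dx), so that this determines c. *)
Definition connection_coefficients m (c : nat -> nat -> R) :=
  forall j, L2_expansion (fun l => norm_legendre (l + m) m)
                         (norm_legendre (j + m + 2) (m + 2))
                         (fun l => c l j).

Definition givens_sin m j : R :=
  Num.sqrt (((j + 1) * (j + 2))%:R / ((j + 2 * m + 3) * (j + 2 * m + 4))%:R).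

Definition givens_cos m j : R :=
  Num.sqrt (((2 * m + 2) * (2 * j + 2 * m + 5))%:R
            / ((j + 2 * m + 3) * (j + 2 * m + 4))%:R).

Definition givens m n j : 'M[R]_(n.+3) :=
  \matrix_(a, b)
    if (a == j :> nat) && (b == j :> nat) then givens_cos m j
    else if (a == j + 2 :> nat) && (b == j + 2 :> nat) then givens_cos m j
    else if (a == j :> nat) && (b == j + 2 :> nat) then givens_sin m j
    else if (a == j + 2 :> nat) && (b == j :> nat) then - givens_sin m j
    else (a == b)%:R.

End Legendre.

(* Main.v *)
From HB Require Import structures.
Require Import Defs.
From mathcomp Require Import ring lra zify.
Import Order.TTheory GRing.Theory Num.Theory.
Import numFieldNormedType.Exports.
Local Open Scope classical_set_scope.
Local Open Scope ring_scope.

(* With L = m + 1/2, let C_k^L be the Gegenbauer polynomials. Comparing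
   coefficients gives
     (C_(k+1)^L)' = 2L C_k^(L+1),
     2L C_k^(L+1) = (2L + k) C_k^L + x (C_k^L)'
                  = - (k + 2) C_(k+2)^L + x (C_(k+2)^L)'.
   Eliminating the shifted polynomials yields the Gegenbauer equation;
   telescoping yields
     2L C_k^(L+1) = sum_(l <= k, l + k even) 2 (L + l) C_l^L.
   The second derivative of C_(j+2)^L is 4L(L+1) C_j^(L+2), so the equation for C_(j+2)^L
   reads
     4L(L+1)(1 - x^2) C_j^(L+2) = 2L(2L+1) C_j^(L+1) - (j+1)(j+2) C_(j+2)^L,
   which is a finite expansion and gives the coefficients after normalization.
   They are the only ones because the functions are orthogonal (integrate the
   derivative of the Wronskian weighted by (1 - x^2)^(m+1)). Finally, the columns
   of G_0 ... G_(k-1) are computed by induction on k: columns b < k are final,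
   and columns k and k + 1 are the corresponding columns of C^(m) truncated to
   the rows a <= b and divided by the cosine of index b. *)

(** * Gegenbauer polynomials: shift relations, differential equation, expansions *)

Section GegenbauerPolynomials.
Context {R : realType}.
Implicit Types (lambda x : R) (k m p i l j : nat).

Lemma pochhammerS lambda k :
  pochhammer lambda k.+1 = lambda * pochhammer (lambda + 1) k.
Proof.
rewrite /pochhammer big_ord_recl addr0; congr (_ * _).
by apply: eq_bigr => i _; rewrite -addrA nat1r.
Qed.

Lemma pochhammerSr lambda k :
  pochhammer lambda k.+1 = pochhammer lambda k * (lambda + k%:R).
Proof. by rewrite /pochhammer big_ord_recr. Qed.

(** The coefficient of X^p in degree k = 2i + p, indexed by [i] and [p] so that no truncated
    subtraction enters the algebra. *)
Definition gegenbauer_term lambda i p : R :=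
  (-1) ^+ i * pochhammer lambda (i + p) / (i`!%:R * p`!%:R) * 2 ^+ p.

Definition gegenbauer_coef lambda k p : R :=
  if (p <= k)%N && ~~ odd (k - p) then gegenbauer_term lambda (k - p)./2 p
  else 0.

Definition gegenbauer_poly lambda k : {poly R} :=
  \poly_(p < k.+1) gegenbauer_coef lambda k p.

Lemma coef_gegenbauer_poly lambda k p :
  (gegenbauer_poly lambda k)`_p = gegenbauer_coef lambda k p.
Proof.
by rewrite coef_poly /gegenbauer_coef ltnS; case: (p <= k)%N.
Qed.

Lemma natfact_neq0 k : k`!%:R != 0 :> R.
Proof. by rewrite pnatr_eq0 -lt0n fact_gt0. Qed.

(** Replaces the parity test by a witness k = 2i + p, so that comparing coefficients becomes a
    rational identity in i and p. *)
Variant gegenbauer_coef_spec lambda k p : R -> Type :=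
| GegenbauerTerm i of k = (i.*2 + p)%N :
    gegenbauer_coef_spec lambda k p (gegenbauer_term lambda i p)
| GegenbauerZero of (forall i, k <> (i.*2 + p)%N) :
    gegenbauer_coef_spec lambda k p 0.

Lemma gegenbauer_coefP lambda k p :
  gegenbauer_coef_spec lambda k p (gegenbauer_coef lambda k p).
Proof.
rewrite /gegenbauer_coef; case: ifPn => [/andP[pk o]|h].
  by constructor; lia.
by constructor => i ki; move: h; rewrite ki leq_addl addnK odd_double.
Qed.

Lemma gegenbauer_coefE lambda i p :
  gegenbauer_coef lambda (i.*2 + p) p = gegenbauer_term lambda i p.
Proof. by rewrite /gegenbauer_coef leq_addl addnK odd_double doubleK. Qed.

Lemma deriv_gegenbauer_poly lambda k :
  (gegenbauer_poly lambda k.+1)^`() =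
  (2 * lambda) *: gegenbauer_poly (lambda + 1) k.
Proof.
apply/polyP => p; rewrite coef_deriv coefZ !coef_gegenbauer_poly.
case: (gegenbauer_coefP _ k p) => [i ->|h].
  rewrite -addnS gegenbauer_coefE /gegenbauer_term addnS pochhammerS factS.
  rewrite exprS -mulr_natr natrM.
  field. by rewrite !natfact_neq0 /= addrC natr1 pnatr_eq0.
case: gegenbauer_coefP => [i|_]; last by rewrite mulr0 mul0rn.
by rewrite addnS => -[] /h.
Qed.

(** At k = 2i + p the factor 2 lambda + k + p is 2 (lambda + i + p), which extends (lambda)_(i+p) to
    lambda (lambda + 1)_(i+p). *)
Lemma gegenbauer_poly_shift lambda k :
  (2 * lambda) *: gegenbauer_poly (lambda + 1) k =
  (2 * lambda + k%:R) *: gegenbauer_poly lambda k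
  + 'X * (gegenbauer_poly lambda k)^`().
Proof.
apply/polyP => p; rewrite coefD coefXM coef_deriv !coefZ !coef_gegenbauer_poly.
have -> : (if p == 0%N then 0 else gegenbauer_coef lambda k p.-1.+1 *+ p.-1.+1)
   = gegenbauer_coef lambda k p *+ p by case: p => //=; rewrite mulr0n.
case: (gegenbauer_coefP _ k p) => [i ->|h].
  rewrite gegenbauer_coefE /gegenbauer_term.
  have := pochhammerS lambda (i + p); rewrite pochhammerSr => E.
  transitivity ((-1) ^+ i * 2 * (lambda * pochhammer (lambda + 1) (i + p))
                  / (i`!%:R * p`!%:R) * 2 ^+ p).
    by field; rewrite !natfact_neq0.
  rewrite -E !natrD -muln2 natrM -mulr_natr; field; by rewrite !natfact_neq0.
case: gegenbauer_coefP => [i /h//|_]; by rewrite !mulr0 mul0rn addr0.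
Qed.

(** At k + 2 = 2(i + 1) + p the factor p - (k + 2) is -2(i + 1), which cancels against (i + 1)!. *)
Lemma gegenbauer_poly_shift2 lambda k :
  (2 * lambda) *: gegenbauer_poly (lambda + 1) k =
  - k.+2%:R *: gegenbauer_poly lambda k.+2
  + 'X * (gegenbauer_poly lambda k.+2)^`().
Proof.
apply/polyP => p; rewrite coefD coefXM coef_deriv !coefZ !coef_gegenbauer_poly.
have -> : (if p == 0%N then 0
           else gegenbauer_coef lambda k.+2 p.-1.+1 *+ p.-1.+1)
   = gegenbauer_coef lambda k.+2 p *+ p by case: p => //=; rewrite mulr0n.
case: (gegenbauer_coefP _ k p) => [i ->|h].
  rewrite -!addSn -doubleS gegenbauer_coefE /gegenbauer_term.
  rewrite addSn pochhammerS exprS factS natrM natrD -muln2 natrM -mulr_natr.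
  field. by rewrite !natfact_neq0 addrC natr1 pnatr_eq0.
case: gegenbauer_coefP => [[|i]|_].
- by move=> ->; rewrite -[_ *+ p]mulr_natl mulNr addNr mulr0.
- by rewrite doubleS !addSn => -[] /h.
- by rewrite !mulr0 mul0rn addr0.
Qed.

Lemma gegenbauer_poly0 lambda : gegenbauer_poly lambda 0 = 1.
Proof.
apply/polyP => -[|p]; rewrite coef_gegenbauer_poly coef1 //.
rewrite /gegenbauer_coef /gegenbauer_term /pochhammer big_ord0 /= !fact0.
by rewrite !expr0 !mulr1 divr1.
Qed.

Lemma gegenbauer_poly1 lambda : gegenbauer_poly lambda 1 = (2 * lambda) *: 'X.
Proof.
apply/polyP => -[|[|p]]; rewrite coef_gegenbauer_poly coefZ coefX ?mulr0 //=.
rewrite /gegenbauer_coef /gegenbauer_term /pochhammer big_ord1 /= addr0.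
by rewrite !mulr1 expr0 mul1r divr1 mulrC.
Qed.

Lemma gegenbauer_poly_ode lambda k : let C := gegenbauer_poly lambda k in
  (1 - 'X^2) * C^`()^`() =
  (2 * lambda + 1) *: ('X * C^`()) - (k%:R * (k%:R + 2 * lambda)) *: C.
Proof.
move=> C; rewrite {}/C; case: k => [|[|k]].
- by rewrite gegenbauer_poly0 derivC linear0 !mulr0 scaler0 mul0r scale0r subr0.
- rewrite gegenbauer_poly1 derivZ derivX derivZ derivC scaler0 mulr0.
  by rewrite -!mul_polyC !rmorphM !rmorphD !rmorph1; ring.
have e1 := deriv_gegenbauer_poly lambda k.+1.
have e2 := deriv_gegenbauer_poly (lambda + 1) k.
have e3 := gegenbauer_poly_shift lambda k.+2.
have e4 := gegenbauer_poly_shift2 (lambda + 1) k.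
have e5 := congr1 (@deriv R) e3.
move: e1 e2 e3 e4 e5.
set C := gegenbauer_poly lambda k.+2.
set D := gegenbauer_poly (lambda + 1) k.+1.
set E := gegenbauer_poly (lambda + 1 + 1) k.
set F := gegenbauer_poly (lambda + 1) k.+2.
rewrite !(derivZ, derivD, derivM) derivX mul1r => e1 e2 e3 e4 e5.
have : C^`()^`() = - k.+2%:R *: ((2 * lambda) *: F)
    + 'X * ((2 * lambda) *: F^`()).
  by rewrite e1 derivZ e2 e4 scalerDr -scalerAr !scalerA [_ * - _]mulrC.
rewrite e5 e3 -!mul_polyC => e6.
(* [e6] expresses C'' through C, C' and X^2 C''; it is applied once, so that its X^2 C'' cancels the
   one on the left. *)
rewrite mulrBl mul1r {1}e6.
by rewrite !(rmorphM, rmorphD, rmorph1, rmorphN) /=; ring.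
Qed.

(** Subtracting the two shift relations eliminates X C' and leaves the step from k to k + 2, with
    increment 2 (lambda + k + 2) C_(k+2). *)
Lemma gegenbauer_poly_even_shift lambda k :
  (2 * lambda) *: gegenbauer_poly (lambda + 1) k =
  \sum_(0 <= l < k.+1 | ~~ odd (l + k))
     (2 * (lambda + l%:R)) *: gegenbauer_poly lambda l.
Proof.
elim/ltn_ind: k => -[|[|k]] IHk.
- by rewrite big_mkcond big_nat1 /= !gegenbauer_poly0 addr0.
- rewrite big_mkcond /= big_nat_recr //= big_nat1 /= add0r !gegenbauer_poly1.
  by rewrite !scalerA; congr (_ *: _); ring.
rewrite big_mkcond !big_nat_recr //= -big_mkcond /= !addnS /= !negbK.
rewrite addnn odd_double addr0 /=.
under eq_bigl do rewrite 2!addnS /= negbK.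
have := IHk k (leqW (ltnSn k)).
rewrite big_mkcond big_nat_recr //= -big_mkcond /= addnn odd_double /= => <-.
rewrite gegenbauer_poly_shift gegenbauer_poly_shift2 -!mul_polyC.
by rewrite !(rmorphM, rmorphD, rmorph1, rmorphN) /=; ring.
Qed.

Lemma gegenbauer_poly_shift_weight lambda j :
  (4 * lambda * (lambda + 1)) *: ((1 - 'X^2) * gegenbauer_poly (lambda + 2) j) =
  (2 * lambda + 1) *: (\sum_(0 <= l < j.+1 | ~~ odd (l + j))
     (2 * (lambda + l%:R)) *: gegenbauer_poly lambda l)
  - (j.+1%:R * j.+2%:R) *: gegenbauer_poly lambda j.+2.
Proof.
rewrite -gegenbauer_poly_even_shift.
have := gegenbauer_poly_ode lambda j.+2; rewrite /=.
rewrite {1}deriv_gegenbauer_poly derivZ deriv_gegenbauer_poly -addrA.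
rewrite gegenbauer_poly_shift2.
have -> : (2 * lambda) *: ((2 * (lambda + 1)) *: gegenbauer_poly (lambda + 2) j)
  = (4 * lambda * (lambda + 1)) *: gegenbauer_poly (lambda + 2) j.
  by rewrite scalerA; congr (_ *: _); ring.
rewrite -scalerAr => ->; rewrite -(natr1 j.+1).
by rewrite -!mul_polyC !(rmorphM, rmorphD, rmorph1, rmorphN) /=; ring.
Qed.

Lemma gegenbauer_polyE lambda k : gegenbauer_poly lambda k =
  \sum_(i < k./2.+1) gegenbauer_term lambda i (k - i.*2) *: 'X^(k - i.*2).
Proof.
apply/polyP => p; rewrite coef_gegenbauer_poly coef_sum.
under eq_bigr do rewrite coefZ coefXn.
case: gegenbauer_coefP => [i ki|h].
  have ik : (i < k./2.+1)%N by lia.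
  have -> : p = (k - i.*2)%N by rewrite ki addKn.
  rewrite (bigD1 (Ordinal ik)) //= eqxx mulr1 big1 ?addr0 // => j.
  rewrite -val_eqE /= => ji; have -> : (k - i.*2 == k - j.*2)%N = false.
    by have := ltn_ord j; lia.
  by rewrite mulr0.
rewrite big1 // => i _; case: eqP => [e|_]; last by rewrite mulr0.
by case: (h i); have := ltn_ord i; lia.
Qed.

Lemma horner_gegenbauer_poly lambda k x :
  (gegenbauer_poly lambda k).[x] = gegenbauer lambda k x.
Proof.
rewrite gegenbauer_polyE horner_sum; apply: eq_bigr => i _.
rewrite !hornerE /gegenbauer_term exprMn mulrA.
congr (_ * pochhammer _ _ / _ * _ * _).
by have := ltn_ord i; lia.
Qed.
End GegenbauerPolynomials.

(** * Integration of polynomials over [-1, 1] *)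

Section PolynomialIntegral.
Context {R : realType}.
Implicit Types (p q : {poly R}).

(** The antiderivative without constant term: at i = 0 the quotient is 0 because the inverse of 0 is
    0. *)
Definition primitive_poly p : {poly R} :=
  \poly_(i < (size p).+1) (p`_i.-1 / i%:R).

Lemma coef_primitive_poly p i : (primitive_poly p)`_i = p`_i.-1 / i%:R.
Proof.
rewrite coef_poly; case: ltnP => // pi.
by rewrite nth_default ?mul0r //; case: i pi.
Qed.

Lemma deriv_primitive_poly p : (primitive_poly p)^`() = p.
Proof.
apply/polyP => i; rewrite coef_deriv coef_primitive_poly /= -[LHS]mulr_natr.
by rewrite divfK // pnatr_eq0.
Qed.

Fact primitive_poly_is_linear : linear primitive_poly.
Proof.
move=> a p q; apply/polyP => i.
by rewrite coefD coefZ !coef_primitive_poly coefD coefZ mulrDl mulrA.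
Qed.

HB.instance Definition _ :=
  GRing.isLinear.Build R {poly R} {poly R} _ primitive_poly
    primitive_poly_is_linear.

(** An algebraic form of the integral over [-1, 1], linear without integrability conditions;
    [integral_horner] identifies it with the Lebesgue integral. *)
Definition poly_integral p : R :=
  (primitive_poly p).[1] - (primitive_poly p).[-1].

Fact poly_integral_is_linear : linear_for *%R poly_integral.
Proof.
move=> a p q; rewrite /poly_integral primitive_poly_is_linear.
by rewrite !(hornerD, hornerZ); ring.
Qed.

HB.instance Definition _ :=
  GRing.isLinear.Build R {poly R} R _ poly_integral poly_integral_is_linear.

Lemma poly_integral_deriv p : poly_integral p^`() = p.[1] - p.[-1].
Proof.
have -> : p = primitive_poly p^`() + (p`_0)%:P.
  apply/polyP => -[|i]; rewrite coefD coefC coef_primitive_poly /=.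
    by rewrite invr0 mulr0 add0r.
  by rewrite coef_deriv -[X in X / _]mulr_natr mulfK ?addr0 // pnatr_eq0.
rewrite /poly_integral derivD derivC addr0 deriv_primitive_poly !hornerE.
by rewrite opprD addrACA subrr addr0.
Qed.

Lemma integral_horner p :
  (\int[lebesgue_measure]_(x in `[(-1)%R, 1%R]) (p.[x])%:E)%E =
  (poly_integral p)%:E.
Proof.
rewrite (@continuous_FTC2 _ (horner p) (horner (primitive_poly p))).
- by rewrite -EFinB.
- by lra.
- by apply/continuous_subspaceT => x; exact: continuous_horner.
- split=> [x _| |]; first exact: derivable_horner.
  + by apply: cvg_at_right_filter; exact: continuous_horner.
  + by apply: cvg_at_left_filter; exact: continuous_horner.
- by move=> x _; rewrite -derivE deriv_primitive_poly.
Qed.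

(** The primitive is nondecreasing on [-1, 1]; equal end values would make it constant there, hence
    constant as a polynomial, and p would be 0. *)
Lemma poly_integral_gt0 p : p != 0 -> (forall x, -1 <= x <= 1 -> 0 <= p.[x]) ->
  0 < poly_integral p.
Proof.
move=> p0 pge0; pose P := primitive_poly p.
have Pmono : {in `[(-1), 1] &, {homo (horner P) : x y / x <= y}}.
  apply: ger0_derive1_le_cc.
  - by move=> x _; exact: derivable_horner.
  - move=> x; rewrite in_itv /= => /andP[/ltW x1 /ltW x2].
    by rewrite -derivE deriv_primitive_poly pge0 // x1.
  - by apply/continuous_subspaceT => x; exact: continuous_horner.
have i1 : (1 : R) \in `[(-1), 1] by rewrite in_itv /=; lra.
have im1 : (-1 : R) \in `[(-1), 1] by rewrite in_itv /=; lra.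
have leN11 : (-1 : R) <= 1 by lra.
rewrite lt_def subr_ge0 [_.[_] <= _]Pmono //.
rewrite andbT; apply: contra_neq p0 => /eqP; rewrite subr_eq0 => /eqP P1.
suff PC : P = (P.[-1])%:P by rewrite -[p]deriv_primitive_poly -/P PC derivC.
apply/eqP; rewrite -subr_eq0; apply/eqP.
(* The points 1/(n + 1) supply as many distinct roots in [-1, 1] as the size of the polynomial. *)
pose u (n : nat) : R := n.+1%:R^-1.
have uI : injective u by move=> a b /invr_inj /eqP; rewrite eqr_nat => /eqP[].
apply: (@roots_geq_poly_eq0 _ _ (map u (iota 0 (size (P - (P.[-1])%:P))))).
- apply/allP => _ /mapP[n _ ->].
  have un : -1 <= u n <= 1.
    rewrite /u; apply/andP; split.
      by apply: le_trans (lerN10 R) _; rewrite invr_ge0.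
    by rewrite invf_le1 // ler1n.
  have iu : u n \in `[(-1), 1] by rewrite in_itv.
  rewrite rootE !hornerE subr_eq0 eq_le.
  have /andP[u1 u2] := un.
  by rewrite -{1}P1 !Pmono.
- by rewrite map_inj_uniq // iota_uniq.
- by rewrite size_map size_iota.
Qed.

End PolynomialIntegral.

(** * Orthogonality for the weight (1 - x^2)^m *)

Section Orthogonality.
Context {R : realType}.
Implicit Types (lambda x : R) (k m l j : nat).

(** The coefficient of X^k is (lambda)_k 2^k / k!, and all its factors are nonzero. *)
Lemma gegenbauer_poly_neq0 lambda k :
  0 < lambda -> gegenbauer_poly lambda k != 0.
Proof.
move=> l0; apply/negP => /eqP/(congr1 (fun p : {poly R} => p`_k)).
rewrite coef_gegenbauer_poly coef0 -[X in gegenbauer_coef _ X _]add0n.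
rewrite -[X in (X + k)%N]double0 gegenbauer_coefE /gegenbauer_term => /eqP.
rewrite expr0 mul1r add0n fact0 mul1r; apply/negP.
rewrite !mulf_neq0 ?invr_eq0 ?natfact_neq0 ?expf_neq0 ?pnatr_eq0 //.
by rewrite prodf_seq_neq0; apply/allP => i _ /=; rewrite gt_eqF // ltr_wpDr.
Qed.

Lemma gegenbauer_poly_orthogonal m k l : k != l ->
  poly_integral ((1 - 'X^2) ^+ m * (gegenbauer_poly (m%:R + 1 / 2 : R) k
                                    * gegenbauer_poly (m%:R + 1 / 2) l)) = 0.
Proof.
set la : R := m%:R + 1 / 2 => kl.
set p := gegenbauer_poly la k; set q := gegenbauer_poly la l.
have ep := gegenbauer_poly_ode la k; have eq := gegenbauer_poly_ode la l.
rewrite /= -/p -/q in ep eq.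
(* Since 2 la + 1 = 2 (m + 1), the first-order terms cancel in the derivative of this weighted
   Wronskian, leaving a multiple of the integrand. *)
pose W := (1 - 'X^2) ^+ m.+1 * (p^`() * q - p * q^`()).
have W' : W^`() = (l%:R * (l%:R + 2 * la) - k%:R * (k%:R + 2 * la))
                  *: ((1 - 'X^2) ^+ m * (p * q)).
  rewrite /W derivM derivB !derivM deriv_exp derivB derivC derivXn expr1 sub0r.
  rewrite -[_ *+ m.+1]mulr_natr.
  transitivity ((1 - 'X^2) ^+ m *
    (- (2 * m.+1%:R) * 'X * (p^`() * q - p * q^`())
    + ((1 - 'X^2) * p^`()^`()) * q - p * ((1 - 'X^2) * q^`()^`()))).
    by rewrite /= [(1 - 'X^2) ^+ m.+1]exprS -[_ *+ 2]mulr_natr; ring.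
  rewrite ep eq; have -> : 2 * la + 1 = 2 * m.+1%:R by rewrite /la -natr1; field.
  by rewrite -!mul_polyC !(rmorphM, rmorphB, rmorphD, rmorph_nat) /=; ring.
have := poly_integral_deriv W; rewrite W' linearZ /= => /eqP.
(* [W] vanishes at both ends, so the difference of eigenvalues times the integral is 0; that
   difference is nonzero for k != l. *)
rewrite /W !hornerE sqrrN !expr1n subrr expr0n /= !mul0r subrr mulf_eq0.
case/orP => [|/eqP //].
have -> : l%:R * (l%:R + 2 * la) - k%:R * (k%:R + 2 * la) =
  (l%:R - k%:R) * (l%:R + k%:R + 2 * la) by ring.
rewrite mulf_eq0 subr_eq0 eqr_nat eq_sym (negbTE kl) /= gt_eqF //.
by rewrite /la ltr_wpDl ?addr_ge0 // mulr_gt0 // ltr_wpDl // divr_gt0.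
Qed.

Lemma poly_integral_gegenbauer_gt0 m k : 0 < poly_integral
  ((1 - 'X^2) ^+ m * (gegenbauer_poly (m%:R + 1 / 2 : R) k
                                    * gegenbauer_poly (m%:R + 1 / 2) k)).
Proof.
apply: poly_integral_gt0 => [|x /andP[x1 x2]].
  rewrite !mulf_neq0 ?expf_neq0 //; last 2 first.
  - by rewrite gegenbauer_poly_neq0 // ltr_wpDl // divr_gt0.
  - by rewrite gegenbauer_poly_neq0 // ltr_wpDl // divr_gt0.
  apply/negP => /eqP/(congr1 (fun p : {poly R} => p.[0])).
  by rewrite !hornerE expr0n /= subr0 => /eqP; rewrite oner_eq0.
rewrite hornerM horner_exp [X in _ * X]hornerM -expr2.
apply: mulr_ge0; last exact: sqr_ge0.
apply: exprn_ge0; rewrite !hornerE.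
by have : 0 <= (1 - x) * (1 + x); [apply: mulr_ge0; lra|lra].
Qed.

(** Parseval's identity for a finite combination: orthogonality removes the cross terms. *)
Lemma poly_integral_sum_sqr m (d : nat -> R) N :
  poly_integral ((1 - 'X^2) ^+ m *
    (\sum_(0 <= l < N) d l *: gegenbauer_poly (m%:R + 1 / 2) l) ^+ 2) =
  \sum_(0 <= l < N) d l ^+ 2 * poly_integral
    ((1 - 'X^2) ^+ m * (gegenbauer_poly (m%:R + 1 / 2) l
                        * gegenbauer_poly (m%:R + 1 / 2) l)).
Proof.
rewrite [(\sum_(_ <= _ < _) _) ^+ 2]expr2 mulr_suml mulr_sumr linear_sum /=.
rewrite !big_mkord.
apply: eq_bigr => i _; rewrite !mulr_sumr linear_sum /=.
rewrite (bigD1 i) //= big1 ?addr0 => [|k ki].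
  by rewrite -scalerAl -!scalerAr scalerA linearZ.
rewrite -scalerAl -!scalerAr scalerA linearZ /=.
by rewrite gegenbauer_poly_orthogonal ?mulr0 // eq_sym.
Qed.

End Orthogonality.

(** * The connection coefficients: expansion and uniqueness *)

Section Connection.
Context {R : realType}.
Implicit Types (lambda x : R) (k m l j : nat).

Lemma sqr_sqrt_onem_sqr x : -1 <= x <= 1 ->
  Num.sqrt (1 - x ^+ 2) ^+ 2 = 1 - x ^+ 2.
Proof.
move=> /andP[x1 x2]; rewrite sqr_sqrtr //.
by have : 0 <= (1 - x) * (1 + x); [apply: mulr_ge0; lra|lra].
Qed.

(** The normalizing square root for degree l + m and order m, where (degree - order)! has become
    l!. *)
Definition legendre_factor m l : R :=
  Num.sqrt (((l + m)%:R + 1 / 2) * (l`!%:R / (l + m + m)`!%:R)).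

Lemma norm_legendreE l m x : norm_legendre (l + m) m x =
  2 ^+ m * pochhammer (1 / 2) m * legendre_factor m l
  * Num.sqrt (1 - x ^+ 2) ^+ m * (gegenbauer_poly (m%:R + 1 / 2) l).[x].
Proof.
rewrite /norm_legendre /assoc_legendre horner_gegenbauer_poly addnK.
rewrite -/(legendre_factor m l) [(- 2) ^+ m]exprNn.
have e : (-1) ^+ m * (-1) ^+ m = 1 :> R by rewrite -expr2 sqrr_sign.
transitivity (((-1) ^+ m * (-1) ^+ m)
  * (2 ^+ m * pochhammer (1 / 2) m * legendre_factor m l
     * Num.sqrt (1 - x ^+ 2) ^+ m * gegenbauer (m%:R + 1 / 2) l x)).
  by ring.
by rewrite e [LHS]mul1r.
Qed.

Lemma horner_gegenbauer_poly_shift_weight lambda j x :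
  4 * lambda * (lambda + 1) *
    ((1 - x ^+ 2) * (gegenbauer_poly (lambda + 2) j).[x]) =
  (2 * lambda + 1) * (\sum_(0 <= l < j.+1 | ~~ odd (l + j))
     2 * (lambda + l%:R) * (gegenbauer_poly lambda l).[x])
  - j.+1%:R * j.+2%:R * (gegenbauer_poly lambda j.+2).[x].
Proof.
have := congr1 (horner^~ x) (gegenbauer_poly_shift_weight lambda j).
rewrite /= hornerD hornerN !hornerZ hornerM hornerD hornerN hornerC hornerXn.
rewrite horner_sum => ->.
by congr (_ * _ - _); apply: eq_bigr => l _; rewrite hornerZ.
Qed.

Definition connection_coef m l j : R :=
  if (l <= j)%N && ~~ odd (l + j) then
    (2 * l + 2 * m + 1)%:R * (2 * m + 2)%:R
    * Num.sqrt ((l + 2 * m)`!%:R / ((l%:R + m%:R + 1 / 2) * l`!%:R)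
                * (((j%:R + m%:R + 5 / 2) * j`!%:R)
                   / (j + 2 * m + 4)`!%:R))
  else if l == (j + 2)%N then
    - Num.sqrt (((j + 1) * (j + 2))%:R
                / ((j + 2 * m + 3) * (j + 2 * m + 4))%:R)
  else 0.

(** Undoes the normalization: with lambda = m + 1/2, the right side carries the coefficient (2
    lambda + 1) 2 (lambda + l) of [gegenbauer_poly_shift_weight]. *)
Lemma connection_coef_even m l j : (l <= j)%N -> ~~ odd (l + j) ->
  connection_coef m l j * legendre_factor m l =
  (2 * m%:R + 2) * (2 * (m%:R + 1 / 2 + l%:R)) * legendre_factor (m + 2) j.
Proof.
move=> lj o; rewrite /connection_coef lj o /= -[LHS]mulrA.
rewrite /legendre_factor -sqrtrM; last first.
  by rewrite mulr_ge0 ?divr_ge0 ?mulr_ge0 ?addr_ge0 ?divr_ge0.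
congr (_ * Num.sqrt _); first by field.
rewrite (_ : (l + 2 * m = l + m + m)%N); last by lia.
rewrite (_ : (j + (m + 2) + (m + 2) = j + 2 * m + 4)%N); last by lia.
field.
by rewrite !natfact_neq0 /= gt_eqF // ltr_wpDl // mulr_ge0 // addr_ge0.
Qed.

Lemma natr_factSS n : n.+2`!%:R = n.+2%:R * n.+1%:R * n`!%:R :> R.
Proof. by rewrite !factS !natrM mulrA. Qed.

Lemma connection_coef_last m j :
  connection_coef m j.+2 j * legendre_factor m j.+2 =
  - (j.+1%:R * j.+2%:R) * legendre_factor (m + 2) j.
Proof.
rewrite /connection_coef; have -> : (j.+2 <= j)%N = false by lia.
have -> : (j.+2 == j + 2)%N by lia.
rewrite /= !mulNr; congr (- _).
rewrite -[j.+1%:R * _]ger0_norm ?mulr_ge0 // -sqrtr_sqr -!sqrtrM; last 2 first.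
- by rewrite sqr_ge0.
- by rewrite divr_ge0.
congr Num.sqrt.
rewrite (_ : (j.+2 + m + m = (j + 2 * m).+2)%N); last by lia.
rewrite (_ : (j + (m + 2) + (m + 2) = (j + 2 * m).+4)%N); last by lia.
rewrite !natr_factSS (_ : (j.+2 + m = j + (m + 2))%N); last by lia.
rewrite !addn3 !addn4 addn1 addn2 !natrM.
by field; rewrite natfact_neq0 /= !gt_eqF ?ltr_wpDr ?addr_ge0 ?mulr_ge0.
Qed.

(** This is [gegenbauer_poly_shift_weight] at lambda = m + 1/2, normalized. The sum may stop
    anywhere past j + 2, which serves both the L^2 and the pointwise limit. *)
Lemma connection_expansion m j N x : (j.+2 < N)%N -> -1 <= x <= 1 ->
  norm_legendre (j + m + 2) (m + 2) x =
  \sum_(0 <= l < N) connection_coef m l j * norm_legendre (l + m) m x.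
Proof.
move=> jN /andP[x1 x2].
have s2 := @sqr_sqrt_onem_sqr x (introT andP (conj x1 x2)).
rewrite (big_cat_nat _ (n := j.+3)) //= [X in _ + X]big_nat
  [X in _ + X]big1 ?addr0; last first.
  move=> l /andP[jl _]; rewrite /connection_coef.
  have -> : (l <= j)%N = false by lia.
  have -> : (l == j + 2)%N = false by lia.
  by rewrite mul0r.
rewrite big_nat_recr //= big_nat_recr //=.
rewrite [connection_coef m j.+1 j]/connection_coef ltnn /=.
have -> : (j.+1 == j + 2)%N = false by lia.
rewrite mul0r addr0.
pose K : R := 2 ^+ m * pochhammer (1 / 2) m * Num.sqrt (1 - x ^+ 2) ^+ m.
have E l : connection_coef m l j * norm_legendre (l + m) m x =
  K * (connection_coef m l j * legendre_factor m l)
  * (gegenbauer_poly (m%:R + 1 / 2) l).[x].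
  by rewrite norm_legendreE /K; ring.
rewrite E connection_coef_last.
have -> : \sum_(0 <= l < j.+1) connection_coef m l j * norm_legendre (l + m) m x =
  K * legendre_factor (m + 2) j * ((2 * m%:R + 2) *
    \sum_(0 <= l < j.+1 | ~~ odd (l + j))
     (2 * (m%:R + 1 / 2 + l%:R)) * (gegenbauer_poly (m%:R + 1 / 2) l).[x]).
  rewrite [in RHS]big_mkcond !mulr_sumr !big_nat.
  apply: eq_bigr => l /andP[_ lj].
  case: ifPn => o; first by rewrite E connection_coef_even //; ring.
  rewrite /connection_coef (negbTE o) andbF.
  have -> : (l == j + 2)%N = false by lia.
  by rewrite mul0r !mulr0.
have := horner_gegenbauer_poly_shift_weight (m%:R + 1 / 2) j x.
have -> : 2 * (m%:R + 1 / 2) + 1 = 2 * m%:R + 2 :> R by field.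
(* Together with the extra 2^2, the two new Pochhammer factors give the constant 4 lambda (lambda +
   1). *)
have P2 : pochhammer (1 / 2) (m + 2) =
  pochhammer (1 / 2) m * (m%:R + 1 / 2) * (m%:R + 1 / 2 + 1) :> R.
  by rewrite addn2 !pochhammerSr -(natr1 m); ring.
move=> e; rewrite -addnA norm_legendreE P2 [Num.sqrt _ ^+ (m + 2)]exprD s2.
have -> : (m + 2)%:R + 1 / 2 = m%:R + 1 / 2 + 2 :> R by rewrite natrD; ring.
transitivity (K * legendre_factor (m + 2) j *
    (4 * (m%:R + 1 / 2) * (m%:R + 1 / 2 + 1) *
      ((1 - x ^+ 2) * (gegenbauer_poly (m%:R + 1 / 2 + 2) j).[x]))).
  by rewrite /K exprD; ring.
by rewrite e; ring.
Qed.

Lemma connection_coefficients_ex m :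
  connection_coefficients m (connection_coef m).
Proof.
move=> j; rewrite /L2_expansion; apply: cvg_near_cst; exists j.+3 => // N /= jN.
rewrite integral0_eq // => x; rewrite /= in_itv /= => x1.
by rewrite -connection_expansion // subrr expr0n.
Qed.

(** From N = j + 3 on, the squared L^2 error of the partial sum is a sum of nonnegative terms
    [d l ^+ 2 * h l]. It tends to 0, so each of them is 0, while [h l] and the factor [K l] of [d l]
    are nonzero. *)
Lemma connection_coefficients_unique m c :
  connection_coefficients m c -> forall l j, c l j = connection_coef m l j.
Proof.
move=> cc k j.
pose h l : R := poly_integral
  ((1 - 'X^2) ^+ m * (gegenbauer_poly (m%:R + 1 / 2) l
                        * gegenbauer_poly (m%:R + 1 / 2) l)).
pose K l : R := 2 ^+ m * pochhammer (1 / 2) m * legendre_factor m l.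
pose d l : R := (connection_coef m l j - c l j) * K l.
have K0 l : K l != 0.
  rewrite !mulf_neq0 ?expf_neq0 //.
    rewrite prodf_seq_neq0; apply/allP => i _ /=.
    by rewrite gt_eqF // ltr_wpDr // divr_gt0.
  rewrite gt_eqF // sqrtr_gt0.
  by rewrite mulr_gt0 ?divr_gt0 ?ltr0n ?fact_gt0 // ltr_wpDl // divr_gt0.
have I N : (j.+2 < N)%N ->
  (\int[lebesgue_measure]_(x in `[(-1)%R, 1%R])
      (((norm_legendre (j + m + 2) (m + 2) x
      - \sum_(0 <= l < N) c l j * norm_legendre (l + m) m x) ^+ 2)%:E))%E =
  (\sum_(0 <= l < N) d l ^+ 2 * h l)%:E.
  move=> jN; rewrite -poly_integral_sum_sqr -integral_horner.
  apply: eq_integral => x; rewrite inE /= in_itv /= => /andP[x1 x2].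
  have s2 := @sqr_sqrt_onem_sqr x (introT andP (conj x1 x2)).
  congr EFin; rewrite (@connection_expansion m j N) // ?x1 // -sumrB.
  rewrite hornerM !horner_exp hornerD hornerN hornerC hornerXn.
  (* The weight (1 - x^2)^m is the square of sqrt(1 - x^2)^m and moves inside the outer square. *)
  rewrite -[X in X ^+ m]s2 -exprM mulnC exprM -exprMn horner_sum mulr_sumr.
  congr (_ ^+ 2); apply: eq_bigr => l _.
  by rewrite !norm_legendreE hornerZ /d /K; ring.
have dk : d k ^+ 2 * h k <= 0.
  rewrite -lee_fin; apply: cvge_to_ge (cc j) _.
  exists (maxn j.+3 k.+1) => // N /=; rewrite geq_max => /andP[jN kN].
  rewrite I // lee_fin big_mkord (bigD1 (Ordinal kN)) //=.
  rewrite lerDl sumr_ge0 // => l _.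
  by rewrite mulr_ge0 ?sqr_ge0 // ltW // poly_integral_gegenbauer_gt0.
move: dk; rewrite pmulr_lle0 ?poly_integral_gegenbauer_gt0 // => dk.
have : d k ^+ 2 == 0 by rewrite eq_le dk sqr_ge0.
rewrite sqrf_eq0 mulf_eq0 (negbTE (K0 k)) orbF subr_eq0.
by move/eqP.
Qed.
End Connection.

(** * Factorization into Givens rotations *)

Section Givens.
Context {R : realType}.
Implicit Types (k m l j n a b : nat).

Lemma givens_cos_gt0 m j : 0 < givens_cos m j :> R.
Proof. by rewrite sqrtr_gt0 divr_gt0 // ltr0n; lia. Qed.

(** What rotation k must produce in the rows up to k of column k + 2, with the cosines cleared from
    the denominators. *)
Lemma connection_coef_step m l k : (l <= k)%N -> ~~ odd (l + k) ->
  connection_coef m l k.+2 * givens_cos m k =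
  givens_sin m k * givens_cos m k.+2 * connection_coef m l k :> R.
Proof.
move=> lk o; rewrite /connection_coef lk o.
have -> : (l <= k.+2)%N by lia.
have -> : ~~ odd (l + k.+2) by lia.
rewrite /= -[LHS]mulrA [RHS]mulrCA; congr (_ * _).
rewrite /givens_sin /givens_cos.
rewrite -!sqrtrM ?mulr_ge0 ?divr_ge0 ?ler0n ?addr_ge0 ?divr_ge0 ?ler0n //;
  last exact: (ler0n R k.+1).
congr Num.sqrt.
rewrite (_ : (k.+2 + 2 * m + 4 = (k + 2 * m + 4).+2)%N); last by lia.
rewrite [k.+2`!%:R]natr_factSS [_.+2`!%:R]natr_factSS.
field.
rewrite !natfact_neq0 /= !gt_eqF ?ltr_wpDl ?addr_ge0 ?mulr_ge0 ?ler0n //.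
Qed.

(** Diagonal position k + 2 is touched by the rotations k and k + 2, whence two cosines; positions 0
    and 1 are touched by one rotation only. *)
Lemma connection_coef_diag m k :
  connection_coef m k.+2 k.+2 = givens_cos m k * givens_cos m k.+2 :> R.
Proof.
rewrite /connection_coef leqnn addnn odd_double /=.
rewrite -[LHS]ger0_norm ?mulr_ge0 ?sqrtr_ge0 ?ler0n //.
rewrite -sqrtr_sqr exprMn sqr_sqrtr; last first.
  rewrite ?mulr_ge0 ?divr_ge0 ?ler0n ?addr_ge0 ?divr_ge0 ?ler0n //.
  exact: (ler0n R k.+1).
rewrite /givens_cos -sqrtrM ?divr_ge0 ?ler0n //; congr Num.sqrt.
rewrite (_ : (k.+2 + 2 * m + 4 = (k.+2 + 2 * m).+4)%N); last by lia.
rewrite [_.+4`!%:R]natr_factSS [(k.+2 + _).+2`!%:R]natr_factSS.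
field.
have := ler0n R m; have := ler0n R k => hk hm.
by rewrite !natfact_neq0 /= !gt_eqF //; lra.
Qed.

Lemma connection_coef_below m l j : (j < l)%N -> l != j.+2 ->
  connection_coef m l j = 0 :> R.
Proof.
move=> jl lj; rewrite /connection_coef leqNgt jl /=.
by have -> : (l == j + 2)%N = false by lia.
Qed.

Lemma connection_coef_odd m l j : odd (l + j) -> connection_coef m l j = 0 :> R.
Proof.
move=> o; rewrite /connection_coef o andbF.
by have -> : (l == j + 2)%N = false by lia.
Qed.

Lemma connection_coef_sub m j : connection_coef m j.+2 j = - givens_sin m j :> R.
Proof.
rewrite /connection_coef.
have -> : (j.+2 <= j)%N = false by lia.
by have -> : (j.+2 == j + 2)%N by lia.
Qed.

Lemma connection_coef_diag_lt2 m b : (b < 2)%N ->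
  connection_coef m b b = givens_cos m b :> R.
Proof.
move=> b2; rewrite /connection_coef leqnn addnn odd_double /=.
rewrite -[LHS]ger0_norm ?mulr_ge0 ?sqrtr_ge0 ?ler0n //.
rewrite -sqrtr_sqr exprMn sqr_sqrtr; last first.
  by rewrite ?mulr_ge0 ?divr_ge0 ?ler0n ?addr_ge0 ?divr_ge0 ?ler0n.
congr Num.sqrt; case: b b2 => [|[|//]] _.
  rewrite !add0n [(2 * m + 4)%N]addn4 [_.+4`!%:R]natr_factSS.
  rewrite [(2 * m).+2`!%:R]natr_factSS.
  by field; have := ler0n R m; rewrite !natfact_neq0 /= !gt_eqF //; lra.
rewrite (_ : (1 + 2 * m + 4 = (1 + 2 * m).+4)%N); last by lia.
rewrite [_.+4`!%:R]natr_factSS [(1 + _).+2`!%:R]natr_factSS.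
by field; have := ler0n R m; rewrite !natfact_neq0 /= !gt_eqF //; lra.
Qed.

(** Right multiplication mixes only columns k and k + 2; the latter is passed as an ordinal so that
    it can index [M]. *)
Lemma mul_givens m n (M : 'M[R]_(n.+3)) (a b k k2 : 'I_n.+3) :
  k2 = k.+2 :> nat ->
  (M *m givens m n k) a b =
    if b == k then givens_cos m k * M a k - givens_sin m k * M a k2
    else if b == k2 then givens_sin m k * M a k + givens_cos m k * M a k2
    else M a b.
Proof.
move=> ek2; rewrite mxE.
have k02 : k != k2 by rewrite -val_eqE /= ek2; lia.
(* The index [j + 2] in [givens] is an addition of the semiring [nat]. *)
have e2 : (k : nat) + 2 = k2 by rewrite ek2; exact: (addn2 k).
under eq_bigr do rewrite mxE e2 !val_eqE.
have [->|bk] := eqVneq b k.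
  rewrite (negbTE k02) (bigD1 k) //= (bigD1 k2) 1?eq_sym //=.
  rewrite !eqxx /= [k2 == k]eq_sym (negbTE k02).
  rewrite big1 ?addr0; first by rewrite /=; ring.
  by move=> i /andP[/negbTE ik /negbTE ik2]; rewrite ik ik2 /= mulr0.
have [->|bk2] := eqVneq b k2.
  rewrite (bigD1 k) //= (bigD1 k2) 1?eq_sym //=.
  rewrite !eqxx /= [k2 == k]eq_sym (negbTE k02).
  rewrite big1 ?addr0; first by rewrite /=; ring.
  by move=> i /andP[/negbTE ik /negbTE ik2]; rewrite ik ik2 /= mulr0.
rewrite (bigD1 b) //= !andbF eqxx mulr1 big1 ?addr0 // => i ib.
by rewrite !andbF (negbTE ib) mulr0.
Qed.

(** Rotation b multiplies column b by its cosine and puts -s_b in row b + 2. Before it, column b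
    lacks both, whence the division and the truncation to a <= b. *)
Lemma prod_givensE m n k (a b : 'I_n.+3) : (k <= n.+1)%N ->
  (\prod_(j < k) givens m n j : 'M[R]_(n.+3)) a b =
    if (b < k)%N then connection_coef m a b
    else if (b < k.+2)%N then
      if (a <= b)%N then connection_coef m a b / givens_cos m b else 0
    else (a == b)%:R.
Proof.
elim: k a b => [|k IHk] a b kn.
  (* In the identity, columns 0 and 1 fit the truncated form: a diagonal entry is a cosine over
     itself, and entry (0, 1) is zero by parity. *)
  rewrite big_ord0 mxE ltn0; case: ifPn => // b2.
  case: ifPn => [ab|]; last first.
    by rewrite -ltnNge -val_eqE /= => ba; rewrite gtn_eqF.
  rewrite -val_eqE /=.
  case: (nat_of_ord b) b2 ab => [|[|//]] _;
    case: (nat_of_ord a) => [|[|//]] // _.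
  - by rewrite connection_coef_diag_lt2 // divff // gt_eqF // givens_cos_gt0.
  - by rewrite connection_coef_odd // mul0r.
  - by rewrite connection_coef_diag_lt2 // divff // gt_eqF // givens_cos_gt0.
have k0P : (k < n.+3)%N by lia.
have k2P : (k.+2 < n.+3)%N by lia.
rewrite big_ord_recr /= (@mul_givens _ _ _ _ _ (Ordinal k0P) (Ordinal k2P)) //.
rewrite !IHk ?(ltnW kn) //= -!val_eqE /= !ltnn.
have -> : (k < k.+2)%N by lia.
have -> : (k.+2 < k)%N = false by lia.
have ck : givens_cos m k != 0 :> R by rewrite gt_eqF // givens_cos_gt0.
have ck2 : givens_cos m k.+2 != 0 :> R by rewrite gt_eqF // givens_cos_gt0.
(* Column k + 2 is still a unit vector, so column k becomes c_k M_k - s_k e_(k+2). *)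
have [bk|bk] := eqVneq (nat_of_ord b) k.
  rewrite bk ltnS leqnn; case: leqP => [ak|ka].
    have -> : (nat_of_ord a == k.+2) = false by lia.
    by rewrite mulr0 subr0 mulrC divfK.
  rewrite mulr0 sub0r; have [->|ak2] := eqVneq (nat_of_ord a) k.+2.
    by rewrite mulr1 connection_coef_sub.
  by rewrite mulr0 oppr0 connection_coef_below.
(* Column k + 2 becomes s_k M_k + c_k e_(k+2): rows a <= k, then k + 1 (zero by parity), k + 2
   (diagonal) and those below (zero). *)
have [bk2|bk2] := eqVneq (nat_of_ord b) k.+2.
  rewrite bk2.
  have -> : (k.+2 < k.+1)%N = false by lia.
  rewrite ltnSn; case: (leqP a k) => [ak|ka].
    have -> : (nat_of_ord a == k.+2) = false by lia.
    rewrite (leqW (leqW ak)) mulr0 addr0.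
    have [ak2|ak2] := boolP (odd (a + k)).
      by rewrite !connection_coef_odd ?mul0r ?mulr0 // !addnS /= negbK.
    rewrite -[connection_coef m a k.+2](mulfK ck) connection_coef_step //.
    by field; rewrite ck ck2.
  rewrite mulr0 add0r; case: (ltngtP (nat_of_ord a) k.+2) => a2.
  - rewrite mulr0 (_ : nat_of_ord a = k.+1) ?leqnSn; last by lia.
    by rewrite connection_coef_odd ?mul0r //; lia.
  - by rewrite mulr0.
  - by rewrite a2 mulr1 connection_coef_diag mulfK.
(* The other columns do not change, and the bounds on b for k and k + 1 agree since b is neither k
   nor k + 2. *)
have -> : (b < k.+1)%N = (b < k)%N by lia.
case: ltnP => // kb.
have -> : (b < k.+3)%N = (b < k.+2)%N by lia.
by [].
Qed.

End Givens.

(** Existence is asserted separately, so that the part quantified over all [c] is not vacuous. *)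
Theorem theorem2p4 (R : realType) (m : nat) :
  (exists c : nat -> nat -> R, connection_coefficients m c) /\
  forall c : nat -> nat -> R, connection_coefficients m c ->
    [/\ (forall (j : nat) (theta : R), 0 <= theta <= pi ->
          series (fun l : nat => c l j * norm_legendre (l + m) m (cos theta)) @ \oo
            --> norm_legendre (j + m + 2) (m + 2) (cos theta)),
        (forall l j : nat,
          c l j =
            if (l <= j)%N && ~~ odd (l + j) then
              (2 * l + 2 * m + 1)%:R * (2 * m + 2)%:R
              * Num.sqrt ((l + 2 * m)`!%:R / ((l%:R + m%:R + 1 / 2) * l`!%:R)
                          * (((j%:R + m%:R + 5 / 2) * j`!%:R)
                             / (j + 2 * m + 4)`!%:R))
            else if l == (j + 2)%N then
              - Num.sqrt (((j + 1) * (j + 2))%:R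
                          / ((j + 2 * m + 3) * (j + 2 * m + 4))%:R)
            else 0)
      & (forall n : nat,
          (\matrix_(l < n.+3, j < n.+1) c l j) =
          (\prod_(j < n.+1) givens m n j) *m (pid_mx n.+1 : 'M[R]_(n.+3, n.+1)))].
Proof.
split; first by exists (connection_coef m); exact: connection_coefficients_ex.
move=> c /connection_coefficients_unique cE; split=> [j theta _|l j|n].
- apply: cvg_near_cst; exists j.+3 => // N /= jN.
  rewrite (@connection_expansion _ m j N) ?cos_geN1 ?cos_le1 //.
  by apply: eq_bigr => l _; rewrite cE.
- exact: cE.
apply/matrixP => a b; rewrite mxE cE mxE.
have bP : (b < n.+3)%N by have := ltn_ord b; lia.
(* The rectangular identity selects the first n + 1 columns, all of them final after n + 1
   rotations. *)
rewrite (bigD1 (Ordinal bP)) //= [X in _ + X]big1 ?addr0 => [|i ib].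
  by rewrite [pid_mx _ _ _]mxE eqxx /= ltn_ord mulr1 prod_givensE //= ltn_ord.
rewrite [pid_mx _ _ _]mxE; case: eqP => [e|_]; last by rewrite mulr0.
by case/eqP: ib; exact: val_inj.
Qed.
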